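(* Let $(G,H)$ be a reduced Hecke pair with Schlichting completion $(\overline G,\overline H)$, let $A=C^*(\overline G)$ and $p=\chi_{\overline H}\in A$. If $(G,H)$ is directed, then $p$ is full in $A$, i.e. the closed linear span $\overline{ApA}$ of $\{apb: a,b\in A\}$ equals $A$.
   Context: $(G,H)$ ($H$ a subgroup of a group $G$) is a Hecke pair if every double coset $HxH$ is a finite union of left cosets of $H$; it is reduced if $\bigcap_{x\in G}xHx^{-1}=\{e\}$. Let $\mathrm{Map}(G/H)$ be the set of all maps $G/H\to G/H$ with the topology of pointwise convergence ($G/H$ discrete), and let $\theta(x)(yH)=xyH$. The Schlichting completion is $\overline G=\overline{\theta(G)}$, $\overline H=\overline{\theta(H)}$ (closures in $\mathrm{Map}(G/H)$); $\overline G$ is a locally compact group of permutations of $G/H$, $\overline H$ is a compact open subgroup, and $G$ is identified with the dense subgroup $\theta(G)$. The pair $(G,H)$ is directed if $G=T^{-1}T$, where $T=\{t\in G: tHt^{-1}\supseteq H\}$. Left Haar measure on $\overline G$ is normalized so that $\overline H$ has measure $1$, so $p=\chi_{\overline H}$ is a projection in $C_c(\overline G)\subseteq A=C^*(\overline G)$ (full group $C^*$-algebra). *)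

(* Defs.v *)
From HB Require Import structures.
From mathcomp Require Import all_boot all_order all_algebra.
From mathcomp Require Import all_classical all_reals all_analysis.
From mathcomp Require Import complex.

Set Implicit Arguments.
Unset Strict Implicit.
Unset Printing Implicit Defensive.

Import Order.TTheory GRing.Theory Num.Theory.
Import numFieldNormedType.Exports.

Local Open Scope classical_set_scope.
Local Open Scope ring_scope.
Local Open Scope complex_scope.

Section HeckePair.
Local Open Scope group_scope.
Variable G : groupType.
Implicit Types (H : set G) (x y : G).

Definition left_translate x (C : set G) : set G := [set x * y | y in C].

Definition right_translate C x : set G := [set y * x | y in C].

Definition conjugate x H : set G := [set x * h * x^-1 | h in H].

Definition double_coset H x : set G := [set h * x * k | h in H & k in H].

Definition hecke_pair H : Prop :=
  group_closed (mem H) /\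
  forall x, exists s : seq G,
    double_coset H x = \bigcup_(y in [set` s]) left_translate y H.

Definition reduced H : Prop := \bigcap_x conjugate x H = [set 1].

Definition expanders H : set G := [set t | H `<=` conjugate t H].

Definition directed H : Prop :=
  [set s^-1 * t | s in expanders H & t in expanders H] = [set: G].

Definition lcosets H : Type := set_type (range (fun x => left_translate x H)).

HB.instance Definition _ H :=
  Choice.copy (lcosets H) (set_type (range (fun x => left_translate x H))).

Definition lcoset H x : lcosets H :=
  exist _ (left_translate x H)
    (mem_set (ex_intro2 (fun=> True) _ x I (erefl (left_translate x H)))).

HB.instance Definition _ H := isPointed.Build (lcosets H) (lcoset H 1).

Definition coset_map H : Type :=
  {ptws lcosets H -> discrete_topology (lcosets H)}.

HB.instance Definition _ H := Topological.copy (coset_map H)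
  {ptws lcosets H -> discrete_topology (lcosets H)}.

Lemma theta_subproof H x (C : lcosets H) :
  left_translate x (val C)
    \in range (fun y => left_translate y H).
Proof.
apply/mem_set; case: C => C /= /set_mem[y _ <-]; exists (x * y) => //.
by rewrite /left_translate image_comp; apply: eq_imagel => z _ /=; rewrite mulgA.
Qed.

Definition theta H x : coset_map H := fun C =>
  (exist _ (left_translate x (val C)) (theta_subproof x C) : lcosets H).
Arguments theta H x _ : clear implicits.

Lemma lcoset_surj H (C : lcosets H) : exists x, C = lcoset H x.
Proof.
case: C => C CP; case: (set_mem CP) => x _ Cx; exists x.
by apply: val_inj; rewrite /= Cx.
Qed.

Lemma theta_lcoset H x y : theta H x (lcoset H y) = lcoset H (x * y).
Proof.
apply: val_inj; rewrite /= /left_translate image_comp.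
by apply: eq_imagel => z _ /=; rewrite mulgA.
Qed.

Lemma theta1 H : theta H 1 = id.
Proof.
by apply/funext => C; have [x ->] := lcoset_surj C; rewrite theta_lcoset mul1g.
Qed.

Lemma thetaM H x y : theta H (x * y) = theta H x \o theta H y.
Proof.
apply/funext => C; have [z ->] := lcoset_surj C.
by rewrite /= !theta_lcoset mulgA.
Qed.

Lemma nbhs_coset_map H (f : coset_map H) (U : set (coset_map H)) :
  nbhs f U <->
  exists s : seq (lcosets H), forall g : coset_map H, {in s, g =1 f} -> U g.
Proof.
split; last first.
  case=> s sU; apply: filterS sU _ => {U}.
  elim: s => [|c s IH]; first by apply: filterS filterT => g _ c; rewrite in_nil.
  have Nc : nbhs f [set g | g c = f c].
    exact: (@proj_continuous _ (fun=> discrete_topology (lcosets H)) c f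
      _ (discrete_set1 (f c))).
  apply: filterS2 IH Nc => g gs gc d.
  by rewrite in_cons => /predU1P[->|/gs].
pose B (s : seq (lcosets H)) := [set g : coset_map H | {in s, g =1 f}].
have FF : Filter (filter_from setT B).
  apply: filter_from_filter; first by exists [::].
  move=> s t _ _; exists (s ++ t) => // g gst; split=> c cs; apply: gst;
    by rewrite mem_cat cs ?orbT.
suff /(_ U) fU : filter_from setT B --> f by move=> /fU[s _ sU]; exists s.
apply/cvg_sup => c V.
rewrite nbhsE => -[W [[W' _ <-] W'f] WV]; exists [:: c] => // g gc.
by apply: WV; rewrite /= gc ?mem_head.
Qed.

Lemma closure_coset_map H (E : set (coset_map H)) f :
  closure E f <->
  forall s : seq (lcosets H), exists2 g : coset_map H, E g & {in s, g =1 f}.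
Proof.
split=> [Ef s|Ef U /nbhs_coset_map[s sU]].
  have [] := Ef [set g : coset_map H | {in s, g =1 f}]; first by apply/nbhs_coset_map; exists s.
  by move=> g [Eg gs]; exists g.
by have [g Eg gs] := Ef s; exists g; split=> //; apply: sU.
Qed.

End HeckePair.

Arguments theta {G} H x _.

HB.mixin Record Group_isTopological X of Group X & PointedTopological X := {
  mulg_continuous : continuous (fun xy : X * X => (xy.1 * xy.2)%g);
  invg_continuous : continuous (fun x : X => x^-1%g)
}.

#[short(type="topGroupType")]
HB.structure Definition TopologicalGroup :=
  {X of Group X & PointedTopological X & Group_isTopological X}.

Section Schlichting.
Local Open Scope group_scope.
Variables (G : groupType) (H : set G).

Let Gbar : set (coset_map H) := closure (range (theta H)).

Lemma closure_theta_comp f g : Gbar f -> Gbar g -> Gbar (f \o g).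
Proof.
move=> /closure_coset_map Ff /closure_coset_map Fg.
apply/closure_coset_map => s.
have [_ [y _ <-] gs] := Fg s; have [_ [x _ <-] fs] := Ff (map g s).
exists (theta H (x * y)); first by exists (x * y).
by move=> c cs; rewrite thetaM /= gs// fs// map_f.
Qed.

Lemma closure_theta_id : Gbar id.
Proof. by apply: subset_closure; exists 1 => //; rewrite theta1. Qed.

Lemma closure_theta_inj f : Gbar f -> injective f.
Proof.
move=> /closure_coset_map Ff c d fcd; have [_ [x _ <-] xf] := Ff [:: c; d].
have : theta H x c = theta H x d by rewrite !xf// !inE eqxx ?orbT.
move=> /(congr1 (theta H x^-1)).
by rewrite -![theta H x^-1 (_ _)]/((theta H x^-1 \o theta H x) _) -thetaM mulVg theta1.
Qed.

Variable hH : hecke_pair H.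

Lemma lcoset_eqP x y : lcoset H x = lcoset H y <-> H (x^-1 * y).
Proof.
have [H1 Hdiv] := hH.1.
have HV h : H h -> H h^-1.
  by move=> Hh; have := Hdiv 1 h H1 (mem_set Hh); rewrite div1g => /set_mem.
have HM h k : H h -> H k -> H (h * k).
  move=> Hh /HV Hk; have := Hdiv h k^-1 (mem_set Hh) (mem_set Hk).
  by rewrite invgK => /set_mem.
split=> [[xy]|Hxy].
  have : left_translate y H y by exists 1; [exact: set_mem|rewrite mulg1].
  by rewrite -xy => -[h Hh <-]; rewrite mulKg.
apply: val_inj => /=; apply/seteqP; split=> z [h Hh <-].
- exists ((x^-1 * y)^-1 * h); first by apply: HM => //; exact: HV.
  by rewrite invgM invgK !mulgA mulgV mul1g.
- by exists (x^-1 * y * h); [exact: HM|rewrite !mulgA mulgV mul1g].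
Qed.

(* The H-orbit of a coset is finite; this is where (G, H) being a Hecke pair
   makes the pointwise limits of translations surjective. *)
Lemma finite_orbit y : exists L : seq (lcosets H),
  forall c, c \in L <-> exists2 h, H h & c = lcoset H (h * y).
Proof.
have [s sE] := hH.2 y; have H1 := set_mem hH.1.1.
exists [seq c <- map (lcoset H) s | `[< exists2 h, H h & c = lcoset H (h * y) >]].
move=> c; rewrite mem_filter; split=> [/andP[/asboolP]//|[h Hh ch]].
apply/andP; split; first by apply/asboolP; exists h.
have : double_coset H y (h * y) by exists h => //; exists 1; rewrite ?mulg1.
rewrite sE => -[z zs [k Hk zk]]; apply/mapP; exists z => //.
by rewrite ch; apply/esym/lcoset_eqP; rewrite -zk mulKg.
Qed.

Lemma closure_theta_surj f : Gbar f -> forall d, exists c, f c = d.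
Proof.
move=> Ff d; have finj := closure_theta_inj Ff.
have [H1 Hdiv] := hH.1.
have [_ [g _ <-] gf] := (closure_coset_map _ _).1 Ff [:: lcoset H 1].
have [y dy] := lcoset_surj (theta H g^-1 d); have [L LE] := finite_orbit y.
pose k := theta H g^-1 \o f.
have kinj : injective k.
  move=> a b /(congr1 (theta H g)); rewrite /k /=.
  by rewrite -![theta H g (_ _)]/((theta H g \o theta H _) _) -thetaM mulgV theta1
    => /finj.
have kL c : c \in L -> k c \in L.
  move=> /LE[h Hh ->]; apply/LE.
  have [_ [x _ <-] xf] := (closure_coset_map _ _).1 Ff
    [:: lcoset H 1; lcoset H (h * y)].
  have Hgx : H (g^-1 * x).
    apply/lcoset_eqP; have := xf (lcoset H 1) (mem_head _ _).
    by rewrite -gf ?mem_head// !theta_lcoset !mulg1.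
  exists (g^-1 * x * h).
    have /set_mem := Hdiv _ _ (mem_set Hgx) (Hdiv _ _ H1 (mem_set Hh)).
    by rewrite div1g invgK.
  by rewrite /k /= -xf ?inE ?eqxx ?orbT// !theta_lcoset !mulgA.
have ukL : uniq (map k (undup L)) by rewrite map_inj_uniq ?undup_uniq.
have skL : {subset map k (undup L) <= undup L}.
  by move=> _ /mapP[c + ->]; rewrite !mem_undup; exact: kL.
have [|_ kLE] := uniq_min_size ukL skL; first by rewrite size_map.
have : theta H g^-1 d \in undup L.
  by rewrite mem_undup dy; apply/LE; exists 1; [exact: set_mem|rewrite mul1g].
rewrite -kLE => /mapP[c _ /(congr1 (theta H g))].
rewrite /k /= -![theta H g (_ _)]/((theta H g \o theta H _) _) -thetaM mulgV theta1.
by move=> ->; exists c.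
Qed.

Lemma closure_theta_inv f : Gbar f ->
  {g : coset_map H | [/\ Gbar g, cancel g f & cancel f g]}.
Proof.
move=> Ff; apply: cid; have finj := closure_theta_inj Ff.
have fsurj := closure_theta_surj Ff.
pose g : coset_map H := fun d => projT1 (cid (fsurj d)).
have gK : cancel g f by move=> d; rewrite /g; case: cid.
have fK : cancel f g by move=> c; apply: finj; rewrite gK.
exists g; split=> //; apply/closure_coset_map => s.
have [_ [x _ <-] xf] := (closure_coset_map _ _).1 Ff (map g s).
exists (theta H x^-1); first by exists x^-1.
move=> c cs; rewrite -{1}[c]gK -xf ?map_f//.
by rewrite -[LHS]/((theta H x^-1 \o theta H x) _) -thetaM mulVg theta1.
Qed.

(* The argument is not used by the carrier, but the group structure is built
   from it. *)
Definition schlichting of hecke_pair H : Type := set_type Gbar.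

HB.instance Definition _ := Topological.copy (schlichting hH) (set_type Gbar).

Implicit Types f g : schlichting hH.

Definition schlichting_of x : schlichting hH :=
  exist _ (theta H x)
    (mem_set (subset_closure (ex_intro2 (fun=> True) _ x I (erefl (theta H x))))).

Definition schlichting_mul f g : schlichting hH :=
  exist _ (val f \o val g)
    (mem_set (closure_theta_comp (set_mem (valP f)) (set_mem (valP g)))).

Definition schlichting_inv f : schlichting hH :=
  let: exist g gP := closure_theta_inv (set_mem (valP f)) in
  exist _ g (mem_set (let: And3 Gg _ _ := gP in Gg)).

Lemma schlichting_invK f : cancel (val f) (val (schlichting_inv f)).
Proof. by rewrite /schlichting_inv; case: closure_theta_inv => g [? ? ?]. Qed.

Lemma schlichting_invKV f : cancel (val (schlichting_inv f)) (val f).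
Proof. by rewrite /schlichting_inv; case: closure_theta_inv => g [? ? ?]. Qed.

Fact schlichting_mulA : associative schlichting_mul.
Proof. by move=> f g h; apply: val_inj. Qed.

Fact schlichting_mul1 : left_id (schlichting_of 1) schlichting_mul.
Proof. by move=> f; apply: val_inj; rewrite /= theta1. Qed.

Fact schlichting_mul1r : right_id (schlichting_of 1) schlichting_mul.
Proof. by move=> f; apply: val_inj; rewrite /= theta1. Qed.

Fact schlichting_mulV :
  left_inverse (schlichting_of 1) schlichting_inv schlichting_mul.
Proof.
move=> f; apply: val_inj; rewrite /= theta1.
by apply/funext => c /=; rewrite schlichting_invK.
Qed.

Fact schlichting_mulVr :
  right_inverse (schlichting_of 1) schlichting_inv schlichting_mul.
Proof.
move=> f; apply: val_inj; rewrite /= theta1.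
by apply/funext => c /=; rewrite schlichting_invKV.
Qed.

HB.instance Definition _ := isGroup.Build (schlichting hH) schlichting_mulA
  schlichting_mul1 schlichting_mul1r schlichting_mulV schlichting_mulVr.

HB.instance Definition _ := isPointed.Build (schlichting hH) (1 : schlichting hH).

Lemma nbhs_schlichting f (U : set (schlichting hH)) :
  nbhs f U <->
  exists s : seq (lcosets H), forall g, {in s, val g =1 val f} -> U g.
Proof.
split=> [|[s sU]].
  rewrite nbhsE => -[V [[W oW <-] Wf] VU].
  have /nbhs_coset_map[s sW] : nbhs (val f) W by exact: open_nbhs_nbhs.
  by exists s => g gs; apply: VU; apply: sW.
have : nbhs f (val @^-1` [set g : coset_map H | {in s, g =1 val f}]).
  by apply: initial_continuous; apply/nbhs_coset_map; exists s.
by apply: filterS => g; exact: sU.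
Qed.

Fact schlichting_mul_continuous :
  continuous (fun fg : schlichting hH * schlichting hH => fg.1 * fg.2).
Proof.
move=> [f g] U /nbhs_schlichting[s sU].
exists ([set f' | {in map (val g) s, val f' =1 val f}],
        [set g' | {in s, val g' =1 val g}]).
  by split; apply/nbhs_schlichting; eexists; move=> h; exact.
case=> f' g' [/= f's g's]; apply: sU => c cs /=.
by rewrite g's// f's// map_f.
Qed.

Fact schlichting_inv_continuous : continuous (fun f => f^-1).
Proof.
move=> f U /nbhs_schlichting[s sU]; apply/nbhs_schlichting.
exists (map (val f^-1) s) => g gs; apply: sU => c cs.
by rewrite -[c in LHS](schlichting_invKV f) -gs ?map_f// schlichting_invK.
Qed.

HB.instance Definition _ := Group_isTopological.Build (schlichting hH)
  schlichting_mul_continuous schlichting_inv_continuous.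

Definition schlichting_sub : set (schlichting hH) :=
  [set f | closure [set theta H h | h in H] (val f)].

Lemma schlichting_subE f :
  schlichting_sub f <-> val f (lcoset H 1) = lcoset H 1.
Proof.
split=> [/closure_coset_map/(_ [:: lcoset H 1])[_ [h Hh <-] hf]|f1].
  rewrite -hf ?mem_head// theta_lcoset mulg1.
  by apply/esym/lcoset_eqP; rewrite invg1 mul1g.
apply/closure_coset_map => s.
have [_ [x _ <-] xf] :=
  (closure_coset_map _ _).1 (set_mem (valP f)) (lcoset H 1 :: s).
exists (theta H x); last by move=> c cs; apply: xf; rewrite in_cons cs orbT.
exists x => //; rewrite -[x]mul1g -invg1; apply/lcoset_eqP.
by rewrite -{1}f1 -xf ?mem_head// theta_lcoset mulg1.
Qed.

Lemma schlichting_sub_near f :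
  \forall g \near f, schlichting_sub g <-> schlichting_sub f.
Proof.
apply/nbhs_schlichting; exists [:: lcoset H 1] => g gf.
by rewrite !schlichting_subE gf ?mem_head.
Qed.

Lemma schlichting_sub_open : open schlichting_sub.
Proof.
rewrite openE => f Hf; apply: filterS (schlichting_sub_near f) => g gf.
exact/gf.
Qed.

Lemma schlichting_sub_closed : closed schlichting_sub.
Proof. by move=> f /(_ _ (schlichting_sub_near f))[g [Hg gf]]; apply/gf. Qed.

Lemma schlichting_sub_compact : compact schlichting_sub.
Proof.
pose orbit (c : lcosets H) : set (discrete_topology (lcosets H)) :=
  [set theta H h c | h in H].
have orbit_compact c : compact (orbit c).
  have [y ->] := lcoset_surj c; have [L LE] := finite_orbit y.
  apply: finite_compact; apply: (sub_finite_set _ (finite_seq L)).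
  by move=> _ [h Hh <-]; apply/LE; exists h => //; rewrite theta_lcoset.
have Kc : compact (closure [set theta H h | h in H]).
  apply: subclosed_compact (tychonoff orbit_compact) _.
    exact: closed_closure.
  move=> f /closure_coset_map Ff c.
  have [_ [h Hh <-] hf] := Ff [:: c].
  by exists h; rewrite ?hf ?mem_head.
move=> F FF FH; have [|f [Hf Ff]] := Kc (val @ F) _.
  by apply: filterS FH => g.
have Gf : f \in Gbar.
  by apply/mem_set; move: f Hf {Ff}; apply: closureS => _ [h _ <-]; exists h.
exists (exist _ f Gf : schlichting hH); split=> // A B FA.
move=> /nbhs_schlichting[s sB].
have [_ [[g Ag <-] gf]] : (val @` A `&` [set g : coset_map H | {in s, g =1 f}]) !=set0.
  apply: Ff; last by apply/nbhs_coset_map; exists s.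
  by rewrite /fmap /=; apply: (@filterS _ F _ A) FA => g Ag; exists g.
by exists g; split=> //; apply: sB.
Qed.

End Schlichting.

Arguments schlichting_sub {G H} hH _.

Notation borel X := (g_sigma_algebraType (@open X)).

Section GroupAlgebra.
Variables (R : realType) (X : topGroupType).
Implicit Types (mu : {measure set (borel X) -> \bar R}) (f g : X -> R[i]).

(* A nonzero left-invariant Radon measure. *)
Record left_haar mu : Prop := {
  haar_nonzero : mu setT != 0%E;
  haar_translate : forall (x : X) (E : set (borel X)), measurable E ->
    mu (left_translate x E) = mu E;
  haar_compact : forall K : set X, compact K -> (mu K < +oo)%E;
  haar_outer : forall E : set (borel X), measurable E ->
    mu E = ereal_inf [set mu U | U in [set U : set X | open U /\ E `<=` U]];
  haar_inner : forall U : set X, open U ->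
    mu U = ereal_sup [set mu K | K in [set K : set X | compact K /\ K `<=` U]]
}.

(* The modular function, normalized by mu (E x) = Delta x * mu E. *)
Definition modular mu (x : X) : R :=
  get [set c : R | forall E : set (borel X), measurable E ->
    mu (right_translate E x) = (c%:E * mu E)%E].

Definition Cc f : Prop :=
  continuous (f : X -> R[i]^o) /\ compact (closure [set x | f x != 0]).

Definition Cintegral mu f : R[i] :=
  (\int[mu]_x complex.Re (f x)) +i* (\int[mu]_x complex.Im (f x)).

Definition convolution mu f g (x : X) : R[i] :=
  Cintegral mu (fun y => f y * g (y^-1 * x)%g).

Definition involution mu f (x : X) : R[i] :=
  ((modular mu x^-1%g)%:C * (f x^-1%g)^*)%C.

Definition L1norm mu f : R := \int[mu]_x complex.Re `|f x|.

End GroupAlgebra.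

Lemma Cc_indic_schlichting_sub (R : realType) (G : groupType) (H : set G)
    (hH : hecke_pair H) :
  Cc (\1_(schlichting_sub hH) : schlichting hH -> R[i]).
Proof.
split.
  move=> f; apply: cvg_near_cst; first exact: (nbhs_filter f).
  apply: (@filterS _ (nbhs f) _ _ _ _ (schlichting_sub_near f)) => g gf /=.
  by rewrite /indic; congr ((nat_of_bool _)%:R); apply/idP/idP
    => /set_mem/gf/mem_set.
suff -> : [set x | (\1_(schlichting_sub hH) x : R[i]) != 0] = schlichting_sub hH.
  rewrite -(closure_id _).1; first exact: schlichting_sub_compact.
  exact: schlichting_sub_closed.
apply/seteqP; split=> x /=; rewrite /indic.
  by case: (boolP (x \in schlichting_sub hH)) => [/set_mem//|_]; rewrite eqxx.
by move=> /mem_set ->; rewrite oner_eq0.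
Qed.

(* The norm of a normedModType over R[i] is R[i]-valued; this is its real value. *)
Definition rnorm (R : realType) (V : normedModType R[i]) (v : V) : R :=
  complex.Re `|v|.

(* The type is in general without unit, so that it is not an algType. *)
HB.mixin Record isCStarAlgebra (R : realType) A of
    CompleteNormedModule R[i] A := {
  cmul : A -> A -> A;
  cstar : A -> A;
  cmulA : associative cmul;
  cmulPl : forall (k : R[i]) (a b c : A),
    cmul (k *: a + b) c = k *: cmul a c + cmul b c;
  cmulPr : forall (k : R[i]) (a b c : A),
    cmul c (k *: a + b) = k *: cmul c a + cmul c b;
  cnormM : forall a b : A, `|cmul a b| <= `|a| * `|b|;
  cstarP : forall (k : R[i]) (a b : A),
    cstar (k *: a + b) = k^*%C *: cstar a + cstar b;
  cstarK : involutive cstar;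
  cstarM : forall a b : A, cstar (cmul a b) = cmul (cstar b) (cstar a);
  cnorm_star : forall a : A, `|cmul (cstar a) a| = `|a| ^+ 2
}.

#[short(type="cstarAlgType")]
HB.structure Definition CStarAlgebra (R : realType) :=
  {A of CompleteNormedModule R[i] A & isCStarAlgebra R A}.

Section GroupCStar.
Variables (R : realType) (X : topGroupType).
Variable mu : {measure set (borel X) -> \bar R}.
Implicit Types (f g : X -> R[i]) (V : completeNormedModType R[i]).

Definition hilbert_dot V (dot : {dot V for @Num.conj R[i]}) : Prop :=
  forall v, `|v| ^+ 2 = dot v v.

(* pi is an L1-norm-decreasing *-representation of C_c(X) on the Hilbert space
   (V, dot); only the values of pi on C_c(X) matter. *)
Record star_rep V (dot : {dot V for @Num.conj R[i]})
    (pi : (X -> R[i]) -> V -> V) : Prop := {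
  rep_op_linear : forall f, Cc f -> linear (pi f);
  rep_op_bounded : forall f, Cc f ->
    forall v, rnorm (pi f v) <= L1norm mu f * rnorm v;
  rep_linear : forall (k : R[i]) f g, Cc f -> Cc g ->
    forall v, pi (fun x => k * f x + g x) v = k *: pi f v + pi g v;
  rep_mul : forall f g, Cc f -> Cc g ->
    forall v, pi (convolution mu f g) v = pi f (pi g v);
  rep_star : forall f, Cc f ->
    forall u v, dot (pi f u) v = dot u (pi (involution mu f) v)
}.

Definition opnorm V (T : V -> V) : R :=
  sup [set rnorm (T v) | v in [set v | rnorm v <= 1]].

Definition cstar_norm f : R :=
  sup [set r | exists V (dot : {dot V for @Num.conj R[i]})
                 (pi : (X -> R[i]) -> V -> V),
                 [/\ hilbert_dot dot, star_rep dot pi & r = opnorm (pi f)]].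

(* A is the completion of the *-algebra C_c(X) for cstar_norm, with canonical
   map iota; only the values of iota on C_c(X) matter. *)
Record group_cstar_algebra (A : cstarAlgType R) (iota : (X -> R[i]) -> A) :
    Prop := {
  iota_linear : forall (k : R[i]) f g, Cc f -> Cc g ->
    iota (fun x => k * f x + g x) = k *: iota f + iota g;
  iota_mul : forall f g, Cc f -> Cc g ->
    iota (convolution mu f g) = cmul (iota f) (iota g);
  iota_star : forall f, Cc f -> iota (involution mu f) = cstar (iota f);
  iota_norm : forall f, Cc f -> rnorm (iota f) = cstar_norm f;
  iota_dense : closure (iota @` [set f | Cc f]) = [set: A]
}.

End GroupCStar.

Definition lin_span (R : realType) (V : normedModType R[i]) (S : set V) :
    set V :=
  [set v | exists n (k : 'I_n -> R[i]) (w : 'I_n -> V),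
     (forall i, S (w i)) /\ v = \sum_i k i *: w i].

Definition full (R : realType) (A : cstarAlgType R) (p : A) : Prop :=
  closure (lin_span [set cmul (cmul a p) b | a in [set: A] & b in [set: A]])
    = [set: A].

(* Main.v *)
Require Import Defs.
From HB Require Import structures.
From mathcomp Require Import all_boot all_order all_algebra.
From mathcomp Require Import all_classical all_reals all_analysis.
From mathcomp Require Import measurable_realfun complex.

Set Implicit Arguments.
Unset Strict Implicit.
Unset Printing Implicit Defensive.

Import Order.TTheory GRing.Theory Num.Theory.
Import numFieldNormedType.Exports.

Local Open Scope classical_set_scope.
Local Open Scope ring_scope.
Local Open Scope complex_scope.

(* For an open compact subgroup L of measure 1 the indicators of left, trivial
   and right translates satisfy 1_{xL} * 1_L * 1_{Ly} = 1_{xLy}, without any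
   modular factor, so the images of all the 1_{xLy} lie in ApA.  With
   y = x^-1 w these are the cosets K w of the conjugates K = x L x^-1.  If the
   conjugates form a neighbourhood base at 1, every f in C_c is uniformly close
   to a finite combination of such 1_{Kw}, supported in the fixed compact set
   L.supp f; hence it is close in L^1, and a fortiori in the C*-norm.
   Directedness provides the neighbourhood base: if t y = a^-1 b with t, a, b
   expanders, then (at)^-1 H (at) is contained in t^-1 H t and in y H y^-1, so
   finitely many conjugates of H always contain a common one t^-1 H t. *)

(** * Subgroups as sets, coset representatives and two-sided translates *)

Section GroupSets.
Local Open Scope group_scope.
Variable G : groupType.
Implicit Types (K : set G) (x y z : G).

Lemma set_group1 K : group_closed (mem K) -> K 1.
Proof. by move=> [K1 _]; exact: set_mem. Qed.

Lemma set_groupM K x y : group_closed (mem K) -> K x -> K y -> K (x * y).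
Proof.
by move=> Kg /mem_set Kx /mem_set Ky; apply: set_mem; exact: (group_closedM Kg).
Qed.

Lemma set_groupV K x : group_closed (mem K) -> K x^-1 <-> K x.
Proof.
move=> Kg; have KV y : K y -> K y^-1.
  by move=> /mem_set Ky; apply: set_mem; exact: (group_closedV Kg).
by split=> [/KV|/KV//]; rewrite invgK.
Qed.

Lemma set_group_cancel K x y : group_closed (mem K) -> K x -> K (x * y) <-> K y.
Proof.
move=> Kg Kx; split=> [Kxy|]; last exact: set_groupM.
by rewrite -[y](mulKg x); apply: set_groupM => //; apply/set_groupV.
Qed.

(** Greedy selection: [a] is kept only if its coset [K a] is not yet represented in [t]. The cosets
    [K w] for [w] in [t] become pairwise disjoint, so a combination of their indicators has at most
    one nonzero term at each point. *)
Lemma coset_transversal K (s : seq G) : group_closed (mem K) ->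
  exists t : seq G, [/\ uniq t, {subset t <= s},
    forall x, x \in s -> exists2 y, y \in t & K (x * y^-1)
    & {in t &, forall x y, K (x * y^-1) -> x = y}].
Proof.
move=> Kg; elim: s => [|a s [t [ut ts st tP]]]; first by exists [::].
have [[b bt Kab]|Na] := pselect (exists2 b, b \in t & K (a * b^-1)).
  exists t; split=> // [x /ts xs|x]; first by rewrite in_cons xs orbT.
  by rewrite in_cons => /predU1P[->|/st//]; exists b.
exists (a :: t); split=> //=.
- rewrite ut andbT; apply/negP => at'; apply: Na; exists a => //.
  by rewrite mulgV; exact: set_group1.
- move=> x; rewrite !in_cons => /predU1P[->|/ts ->]; last by rewrite orbT.
  by rewrite eqxx.
- move=> x; rewrite in_cons => /predU1P[->|/st[y yt Kxy]].
    by exists a; rewrite ?mem_head// mulgV; exact: set_group1.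
  by exists y => //; rewrite in_cons yt orbT.
- move=> x y; rewrite !in_cons => /predU1P[->|xt] /predU1P[->|yt]//.
  + by move=> Kay; case: Na; exists y.
  + move=> Kxa; case: Na; exists x => //.
    by apply/set_groupV; rewrite // invgM invgK.
  + exact: tP.
Qed.

(** The translate [xKy], written as a preimage so that membership unfolds to membership in [K]. One
    form covers left cosets, right cosets and conjugates. *)
Definition bitranslate K x y : set G := [set z | K (x^-1 * z * y^-1)].

Lemma bitranslateE K x y :
  bitranslate K x y = [set x * z * y | z in K].
Proof.
apply/seteqP; split=> z /=; rewrite /bitranslate /=; last first.
  by move=> [w Kw <-]; rewrite !mulgA mulVg mul1g mulgK.
by move=> Kz; exists (x^-1 * z * y^-1); rewrite // !mulgA mulgV mul1g mulgVK.
Qed.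

Lemma bitranslate1 K : bitranslate K 1 1 = K.
Proof. by apply/funext => z; rewrite /bitranslate /= invg1 mul1g mulg1. Qed.

Lemma group_closed_conj K x :
  group_closed (mem K) -> group_closed (mem (bitranslate K x x^-1)).
Proof.
move=> Kg; split=> [|y z /set_mem Ky /set_mem Kz]; apply/mem_set.
  by rewrite /bitranslate /= invgK mulg1 mulVg; exact: set_group1.
rewrite /bitranslate /= !invgK in Ky Kz *.
rewrite [_ * _ * x](_ : _ = (x^-1 * y * x) * (x^-1 * z * x)^-1).
  by apply: set_groupM => //; apply/set_groupV.
by rewrite !invgM invgK !mulgA mulgK.
Qed.

(** The set [xKy] is a right coset of the conjugate [xKx^-1], namely the one through [x * y]. *)
Lemma bitranslate_conj K x y z w : group_closed (mem K) ->
  bitranslate K x x^-1 w -> bitranslate K x y (w * z) <-> bitranslate K x y z.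
Proof.
rewrite /bitranslate /= invgK => Kg Kw.
rewrite [_ * _ * y^-1](_ : _ = (x^-1 * w * x) * (x^-1 * z * y^-1)).
  exact: set_group_cancel.
by rewrite !mulgA mulgK.
Qed.

Lemma bitranslate_coset K x z w :
  bitranslate K x (x^-1 * w) z <-> bitranslate K x x^-1 (z * w^-1).
Proof. by rewrite /bitranslate /= invgM !invgK !mulgA. Qed.

End GroupSets.

(** * Translates of open compact subgroups in a topological group *)

Section OpenSubgroup.
Local Open Scope group_scope.
Variable X : topGroupType.
Implicit Types (L U : set X) (x y z : X).

Lemma bimul_continuous x y : continuous (fun z : X => x * z * y).
Proof.
have mul_cvg (f g : X -> X) : continuous f -> continuous g ->
    continuous (fun z => f z * g z).
  move=> cf cg z.
  have fg : (fun z => (f z, g z)) @ z --> (f z, g z).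
    by apply: cvg_pair (cf z) (cg z).
  exact: (cvg_comp _ _ fg (@mulg_continuous X (f z, g z))).
apply: (mul_cvg (fun z => x * z) (fun=> y)); last by move=> z; exact: cvg_cst.
by apply: (mul_cvg (fun=> x) id) => z; [exact: cvg_cst|exact: cvg_id].
Qed.

Lemma bitranslate_open L x y : open L -> open (bitranslate L x y).
Proof. by move=> /open_comp; apply=> z _; exact: bimul_continuous. Qed.

Lemma bitranslate_compact L x y : compact L -> compact (bitranslate L x y).
Proof.
rewrite bitranslateE; apply: continuous_compact.
by apply: continuous_subspaceT; exact: bimul_continuous.
Qed.

Lemma near_mulV (U : set X) z : nbhs (1 : X) U -> \forall w \near z, U (w * z^-1).
Proof.
move=> U1; have U1' : nbhs (1 * z * z^-1) U by rewrite mul1g mulgV.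
have := @bimul_continuous 1 z^-1 z U U1'.
by rewrite /nbhs /=; apply: filterS => w; rewrite /= mul1g.
Qed.

(** The right coset [L z] is a neighbourhood of [z] on which [P] is constant. *)
Lemma near_invariant L (P : X -> Prop) z : open L -> group_closed (mem L) ->
  (forall x y, L x -> P (x * y) <-> P y) -> \forall w \near z, P w <-> P z.
Proof.
move=> oL gL LP.
have : nbhs 1 L by apply: open_nbhs_nbhs; split=> //; exact: set_group1.
move=> /(near_mulV z); apply: filterS => w Lw.
by have := LP _ z Lw; rewrite mulgVK.
Qed.

Lemma near_clopen (P : set X) :
  (forall z, \forall w \near z, P w <-> P z) -> open P /\ closed P.
Proof.
move=> nP; split; last by move=> z /(_ _ (nP z))[w [Pw wz]]; apply/wz.
by rewrite openE => z Pz; apply: filterS (nP z) => w wz; apply/wz.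
Qed.

Lemma near_bitranslate L x y z : open L -> group_closed (mem L) ->
  \forall w \near z, bitranslate L x y w <-> bitranslate L x y z.
Proof.
move=> oL gL; apply: (@near_invariant (bitranslate L x x^-1)).
- exact: bitranslate_open.
- exact: group_closed_conj.
- by move=> a b; exact: bitranslate_conj.
Qed.

(** Take [U = LC]: it is compact as the image of [L * C] under multiplication, and open as a union
    of right cosets of [L]. It serves as a set of finite measure that contains a given support and
    is preserved by every conjugate lying inside [L]. *)
Lemma saturation (L C : set X) : open L -> compact L -> group_closed (mem L) ->
  compact C -> exists U, [/\ C `<=` U, compact U, open U
    & forall x y, L x -> U (x * y) <-> U y].
Proof.
move=> oL cL gL cC; pose U := [set x * y | x in L & y in C].
have LU x y : L x -> U (x * y) <-> U y.
  have U_mul a b : L a -> U b -> U (a * b).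
    move=> La [c Lc [d Cd <-]]; exists (a * c); first exact: set_groupM.
    by exists d; rewrite ?mulgA.
  move=> Lx; split=> [|Uy]; last exact: U_mul.
  by rewrite -{2}[y](mulKg x); apply: U_mul; apply/set_groupV.
exists U; split=> //.
- by move=> z Cz; exists 1; [exact: set_group1|exists z; rewrite ?mul1g].
- have -> : U = (fun p : X * X => p.1 * p.2) @` (L `*` C).
    apply/seteqP; split=> z; first by move=> [a La [b Cb <-]]; exists (a, b).
    by move=> [[a b] [La Cb] <-]; exists a => //; exists b.
  apply: continuous_compact; last exact: compact_setX.
  by apply: continuous_subspaceT; exact: mulg_continuous.
- by apply: (near_clopen _).1 => z; exact: near_invariant LU.
Qed.

End OpenSubgroup.

(** * Norm estimates and convolution of indicators *)

Section GroupAlgebraLemmas.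
Variables (R : realType) (X : topGroupType).
Variable mu : {measure set (borel X) -> \bar R}.
Implicit Types (f g : X -> R[i]) (U L : set X).

(** Comparison in [R[i]] demands equal imaginary parts; both sides here are real, so their real
    parts decide. *)
Lemma rnorm_lt (V : normedModType R[i]) (v : V) (e : R[i]) :
  0 < e -> rnorm v < complex.Re e -> `|v| < e.
Proof.
rewrite ltcE => /andP[/eqP/= e0 _] ve; rewrite ltcE ve andbT e0.
by have := normr_ge0 v; rewrite lecE => /andP[/eqP/= ->].
Qed.

Lemma measurable_open (U : set X) : open U -> measurable (U : set (borel X)).
Proof. by move=> oU; exact: sub_sigma_algebra. Qed.

Lemma Cintegral_indic (E : set (borel X)) : measurable E ->
  Cintegral mu (\1_E : X -> R[i]) = (fine (mu E))%:C.
Proof.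
move=> mE; rewrite /Cintegral; congr (_ +i* _); last first.
  under eq_Rintegral => x _.
    rewrite (_ : complex.Im _ = 0); last by rewrite /indic; case: (x \in E).
    over.
  by rewrite /Rintegral integral0.
under eq_Rintegral => x _.
  rewrite (_ : complex.Re _ = \1_E x); last by rewrite /indic; case: (x \in E).
  over.
by rewrite /Rintegral integral_indic// setIT.
Qed.

Lemma L1norm_ge0 f : 0 <= L1norm mu f.
Proof.
by apply: Rintegral_ge0 => x _; have := normr_ge0 (f x); rewrite lecE => /andP[_].
Qed.

Lemma L1norm_le f U (e : R) : 0 <= e -> measurable (U : set (borel X)) ->
  (mu U < +oo)%E -> (forall x, `|f x| <= e%:C * \1_U x) ->
  L1norm mu f <= e * fine (mu U).
Proof.
move=> e0 mU Uoo fU; rewrite /L1norm /Rintegral.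
have fU' x : 0 <= complex.Re `|f x| <= e * \1_U x.
  have := normr_ge0 (f x); have := fU x; rewrite !lecE => /andP[_ +] /andP[_ ->].
  by rewrite /indic; case: (x \in U); rewrite /= !(mulr1, mulr0, mul0r, subr0).
have le : (\int[mu]_x (complex.Re `|f x|)%:E <= e%:E * mu U)%E.
  have -> : (e%:E * mu U = \int[mu]_x (e * \1_U x)%:E)%E.
    rewrite -[in LHS](setIT U) -integral_indic// -ge0_integralZl_EFin//.
    by apply/measurable_EFinP; exact: measurable_indic.
  (* Both integrals are suprema over simple functions, and a simple function below [|f|] also lies
     below [e * \1_U]. *)
  rewrite !ge0_integralTE.
  - apply: le_ereal_sup => _ [h hf <-]; exists h => // x.
    apply: le_trans (hf x) _; rewrite lee_fin.
    by case/andP: (fU' x).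
  - by move=> x; rewrite lee_fin mulr_ge0.
  - by move=> x; rewrite lee_fin; case/andP: (fU' x).
have mUfin : mu U \is a fin_num by rewrite ge0_fin_numE.
rewrite -[e]/(fine e%:E) -fineM// fine_le// ?fin_numM// ge0_fin_numE.
  by apply: le_lt_trans le _; rewrite -ge0_fin_numE ?fin_numM// mule_ge0.
by apply: integral_ge0 => x _; rewrite lee_fin; case/andP: (fU' x).
Qed.

Lemma opnorm_le (V : completeNormedModType R[i]) (T : V -> V) (c : R) :
  0 <= c -> (forall v, rnorm (T v) <= c * rnorm v) -> opnorm T <= c.
Proof.
move=> c0 Tc; apply: ge_sup.
  by exists (rnorm (T 0)); exists 0 => //=; rewrite /rnorm normr0.
move=> _ [v /= v1 <-]; apply: le_trans (Tc v) _.
by rewrite -[leRHS]mulr1 ler_wpM2l.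
Qed.

Lemma cstar_norm_le f : Cc f -> cstar_norm mu f <= L1norm mu f.
Proof.
move=> Cf; rewrite /cstar_norm; set S := [set r | _].
(* [sup] takes the default value 0 on the empty set, so that case is covered by nonnegativity of the
   L1 norm. *)
have [->|S0] := eqVneq S set0; first by rewrite sup0 L1norm_ge0.
apply: ge_sup; first exact/set0P.
move=> _ [V [dot [pi [_ rep ->]]]]; apply: opnorm_le; first exact: L1norm_ge0.
exact: (rep_op_bounded rep Cf).
Qed.

Lemma Cc_lincomb (k : R[i]) f g : Cc f -> Cc g -> Cc (fun x => k * f x + g x).
Proof.
move=> [cf Kf] [cg Kg]; split.
  move=> x; apply: cvgD; last exact: cg.
  by apply: (@cvgZr _ R[i]^o) => //; exact: cf.
apply: (subclosed_compact _ (compactU Kf Kg)); first exact: closed_closure.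
rewrite -closureU; apply: closureS => x /=; apply: contra_neqP.
by move=> /not_orP[/negP/negPn/eqP-> /negP/negPn/eqP->]; rewrite mulr0 addr0.
Qed.

Lemma Cc_indic U : (forall z, \forall w \near z, U w <-> U z) -> compact U ->
  Cc (\1_U : X -> R[i]).
Proof.
move=> nU cU; split.
  move=> z; apply: cvg_near_cst.
  apply: filterS (nU z) => w wz /=.
  by rewrite /indic; congr ((nat_of_bool _)%:R); apply/idP/idP
    => /set_mem/wz/mem_set.
apply: (subclosed_compact _ cU); first exact: closed_closure.
rewrite [X in _ `<=` X](closure_id U).1; last exact: (near_clopen nU).2.
apply: closureS => z /=; rewrite /indic.
by case: (boolP (z \in U)) => [/set_mem//|_]; rewrite eqxx.
Qed.

Lemma Cc_bitranslate L x y : open L -> compact L -> group_closed (mem L) ->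
  Cc (\1_(bitranslate L x y) : X -> R[i]).
Proof.
move=> oL cL gL; apply: Cc_indic; last exact: bitranslate_compact.
by move=> z; exact: near_bitranslate.
Qed.

(** For fixed [z] the integrand is the indicator of [xL] if [z] lies in [xLy], and 0 otherwise; the
    set [E] encodes both cases. Left invariance gives [xL] measure 1. *)
Lemma convolution_bitranslate L x y : left_haar mu -> open L ->
  group_closed (mem L) -> mu L = 1%E ->
  convolution mu \1_(bitranslate L x 1) \1_(bitranslate L 1 y)
    = \1_(bitranslate L x y).
Proof.
move=> haar oL gL muL; apply/funext => z; rewrite /convolution.
pose E : set (borel X) := [set w | bitranslate L x 1 w /\ bitranslate L x y z].
have -> : (fun w : X => \1_(bitranslate L x 1) w
    * \1_(bitranslate L 1 y) (w^-1 * z)%g) = (\1_E : X -> R[i]).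
  apply/funext => w; rewrite /indic -natrM mulnb; congr ((nat_of_bool _)%:R).
  apply/andP/idP => [[/set_mem Lw /set_mem Lz]|/set_mem[Lw Lz]].
    apply/mem_set; split=> //; move: Lw Lz.
    rewrite /bitranslate /= !invg1 mul1g mulg1.
    by move=> Lw Lz; have := set_groupM gL Lw Lz; rewrite !mulgA mulgK.
  split; apply/mem_set => //.
  move: Lw Lz; rewrite /bitranslate /= !invg1 mul1g mulg1 => Lw Lz.
  by apply/(set_group_cancel _ gL Lw); rewrite !mulgA mulgK.
have [Lz|NLz] := pselect (bitranslate L x y z); last first.
  have -> : E = set0 by rewrite -subset0 => w [].
  by rewrite Cintegral_indic// measure0 /indic memNset.
have -> : E = left_translate x L.
  apply/seteqP; split=> w; rewrite /E /bitranslate /= invg1 mulg1.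
    by move=> [Lw _]; exists (x^-1 * w)%g; rewrite // mulVKg.
  by move=> [l Ll <-]; rewrite mulKg.
have mL := measurable_open oL.
rewrite Cintegral_indic; last first.
  have -> : left_translate x L = bitranslate L x 1.
    by rewrite bitranslateE; apply: eq_imagel => w _; rewrite mulg1.
  by apply: measurable_open; exact: bitranslate_open.
by rewrite haar_translate// muL /indic mem_set.
Qed.

End GroupAlgebraLemmas.

(** * Approximation by coset indicators, and fullness of the projection *)

Section Fullness.
Variables (R : realType) (X : topGroupType).
Variable mu : {measure set (borel X) -> \bar R}.
Hypothesis haar : left_haar mu.
Implicit Types (f : X -> R[i]) (U L : set X).

(** The difference [f (k * z) - f z] is jointly continuous in [(z, k)] and vanishes at [k = 1]; the
    near-covering form of compactness yields one neighbourhood of 1 valid for all [z] in [U]. *)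
Lemma uniform_left_continuity f U (e : R[i]) : continuous (f : X -> R[i]^o) ->
  compact U -> 0 < e ->
  \forall k \near (1%g : X), forall z, U z -> `|f (k * z)%g - f z| < e.
Proof.
move=> cf cU e0.
apply: ((compact_near_coveringP U).1 cU X (nbhs (1%g : X))
  (fun k z => `|f (k * z)%g - f z| < e)) => z _.
have mz : (fun p : X * X => (p.2 * p.1)%g) @ (z, 1%g) --> z.
  rewrite -[X in _ --> X]mul1g.
  have sw : (fun p : X * X => (p.2, p.1)) @ (z, 1%g) --> (1%g, z).
    by apply: cvg_pair; [exact: cvg_snd|exact: cvg_fst].
  exact: (cvg_comp _ _ sw (@mulg_continuous X (1%g, z))).
have fz : (fun p : X * X => f p.1 : R[i]^o) @ (z, 1%g)
    --> (f z : R[i]^o).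
  exact: (cvg_comp _ _ (@cvg_fst _ _ (nbhs z) (nbhs (1%g : X)) _) (cf z)).
have fmz : (fun p : X * X => f (p.2 * p.1)%g : R[i]^o) @ (z, 1%g)
    --> (f z : R[i]^o).
  exact: (cvg_comp _ _ mz (cf z)).
have f0 : (fun p : X * X => f (p.2 * p.1)%g - f p.1 : R[i]^o) @ (z, 1%g)
    --> (0 : R[i]^o).
  by rewrite -(subrr (f z : R[i]^o)); apply: cvgB.
exact: (cvgr0_norm_lt _ f0 e e0).
Qed.

Lemma finite_coset_cover U L : compact U -> open L -> group_closed (mem L) ->
  exists s : seq X, (forall w, w \in s -> U w) /\
    forall z, U z -> exists2 w, w \in s & L (z * w^-1)%g.
Proof.
move=> cU oL gL.
have oLw w : open (bitranslate L 1%g w) by exact: bitranslate_open.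
have := cU; rewrite compact_cover => /(_ X U (bitranslate L 1%g)).
case=> [w _ //|z Uz|D DU UD].
  by exists z => //; rewrite /bitranslate /= invg1 mul1g mulgV; exact: set_group1.
exists (finmap.enum_fset D); split=> [w /DU/set_mem//|z /UD[w wD]].
by rewrite /bitranslate /= invg1 mul1g => Lz; exists w.
Qed.

(** The step function with value [f w] on [K w] is uniformly close to [f] and supported in [U].
    Since [U] is fixed before [K], its measure does not depend on how small [K] must be. The
    difference has the shape [k * f + g] of [iota_linear]. *)
Lemma L1_approx L f (e : R) : open L -> compact L -> group_closed (mem L) ->
  (forall U : set X, nbhs (1%g : X) U ->
     exists x, bitranslate L x x^-1%g `<=` U) ->
  Cc f -> 0 < e ->
  exists (x : X) (s : seq X), L1norm mu (fun z => -1 *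
    (\sum_(w <- s) f w * \1_(bitranslate L x (x^-1 * w)%g) z) + f z) <= e.
Proof.
move=> oL cL gL Lbase [cf Kf] e0.
have [U [fU cU oU LU]] := saturation oL cL gL Kf.
have mU := measurable_open oU; have Uoo := haar_compact haar cU.
pose M := fine (mu U); have M0 : 0 <= M by exact: fine_ge0.
(* Adding 1 keeps [d] positive even if [M = 0], while [d * M <= e]. *)
pose d := e / (M + 1); have d0 : 0 < d by rewrite divr_gt0// ltr_wpDl.
have L1 : nbhs (1%g : X) L.
  by apply: open_nbhs_nbhs; split=> //; exact: set_group1.
have d0C : 0 < d%:C by rewrite ltcR.
(* The conjugate lies in [L], hence preserves [U], and is also small enough that [f] varies by less
   than [d] along its cosets in [U]. *)
have [x KLd] := Lbase _ (filterI L1 (uniform_left_continuity cf cU d0C)).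
pose K := bitranslate L x x^-1%g.
have gK : group_closed (mem K) by exact: group_closed_conj.
have oK : open K by exact: bitranslate_open.
have [s [sU Us]] := finite_coset_cover cU oK gK.
have [t [ut ts st tP]] := coset_transversal s gK.
exists x, t.
have KU k z : K k -> U (k * z)%g <-> U z by move=> /KLd[/LU].
apply: (@le_trans _ _ (d * M)); last first.
  rewrite /d mulrAC ler_pdivrMr ?ltr_wpDl//.
  by apply: ler_wpM2l; [exact: ltW|rewrite lerDl].
apply: L1norm_le => //; first exact: ltW.
move=> z; rewrite mulN1r addrC.
have tE w : (z \in bitranslate L x (x^-1 * w)%g) = (z * w^-1 \in K)%g.
  by apply/idP/idP => /set_mem Kz; apply/mem_set; apply/bitranslate_coset.
under eq_bigr do rewrite /indic tE.
(* Outside [U] both functions vanish: [z] in [K w] with [w] in [U] would force [z] into [U]. *)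
have [Uz|NUz] := pselect (U z); last first.
  rewrite [X in _ * X](_ : _ = 0) ?mulr0; last by rewrite /indic memNset.
  rewrite big_seq big1 => [|w wt].
    have [->|fz] := eqVneq (f z) 0; first by rewrite subrr normr0.
    by case: NUz; apply: fU; apply: subset_closure.
  rewrite memNset ?mulr0// => Kzw; apply: NUz.
  by rewrite -[z](mulgVK w); apply/(KU _ _ Kzw); apply: sU; exact: ts.
rewrite [X in _ * X](_ : _ = 1) ?mulr1; last by rewrite /indic mem_set.
have [a /st[w wt Kaw] Kza] := Us z Uz.
have Kzw : K (z * w^-1)%g.
  by have := set_groupM gK Kza Kaw; rewrite mulgA mulgVK.
(* Only the term of [w] survives: if [z] lay in [K v] too, then [v * w^-1] would be in [K], so
   [v = w] by the transversal property. *)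
rewrite (bigD1_seq w)//= mem_set// mulr1 big_seq_cond big1 => [|v /andP[vt vw]].
  rewrite addr0 -[z in f z](mulgVK w); apply: ltW.
  by apply: (KLd _ Kzw).2; apply: sU; exact: ts.
rewrite memNset ?mulr0// => Kzv; move/eqP: vw; apply; apply: tP => //.
have := set_groupM gK (_ : K (v * z^-1)%g) Kzw; rewrite mulgA mulgVK; apply.
by apply/set_groupV; rewrite // invgM invgK.
Qed.

Variables (A : cstarAlgType R) (iota : (X -> R[i]) -> A).
Hypothesis A_cstar : group_cstar_algebra mu iota.

Lemma iota_sum (s : seq X) (c : X -> R[i]) (g : X -> X -> R[i]) :
  (forall w, Cc (g w)) ->
  Cc (fun z => \sum_(w <- s) c w * g w z) /\
  iota (fun z => \sum_(w <- s) c w * g w z) = \sum_(w <- s) c w *: iota (g w).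
Proof.
move=> Cg; elim: s => [|w s [Cs iE]].
  under eq_fun do rewrite big_nil.
  rewrite big_nil.
  have C0 : Cc (fun _ : X => 0 : R[i]).
    split; first by move=> z; exact: cvg_cst.
    rewrite (_ : [set _ | _] = set0) ?closure0; first exact: compact0.
    by rewrite -subset0 => z /=; rewrite eqxx.
  split=> //.
  (* Linearity with [k = -1] on the zero function gives [iota 0 = - iota 0 + iota 0 = 0]. *)
  have := iota_linear A_cstar (-1) C0 C0.
  under eq_fun do rewrite mulr0 addr0.
  by rewrite scaleN1r addNr.
under eq_fun do rewrite big_cons.
by rewrite big_cons -iE -(iota_linear A_cstar)//; split=> //; exact: Cc_lincomb.
Qed.

Theorem full_indic_open_subgroup (L : set X) :
  open L -> compact L -> group_closed (mem L) -> mu L = 1%E ->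
  (forall U : set X, nbhs (1%g : X) U ->
     exists x, bitranslate L x x^-1%g `<=` U) ->
  full (iota \1_L).
Proof.
move=> oL cL gL muL Lbase; rewrite /full; set S := lin_span _.
suff iS : iota @` [set f | Cc f] `<=` closure S.
  apply/seteqP; split=> // a _.
  rewrite (closure_id (closure S)).1; last exact: closed_closure.
  have : closure (iota @` [set f | Cc f]) a by rewrite (iota_dense A_cstar).
  by move: a; apply: closureS.
move=> _ [f Cf <-] B /nbhs_ballP[e /= e0 eB].
(* Halving turns the non-strict L1 bound into the strict one required by the ball. *)
have e0' : 0 < complex.Re e / 2.
  by move: e0; rewrite ltcE => /andP[_ /= ?]; rewrite divr_gt0.
have [x [s fs]] := L1_approx oL cL gL Lbase Cf e0'.
pose g w : X -> R[i] := \1_(bitranslate L x (x^-1 * w)%g).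
have Cg w : Cc (g w) by exact: Cc_bitranslate.
have [Cs iE] := iota_sum s f Cg.
exists (\sum_(w <- s) f w *: iota (g w)); split.
  exists (size s), (fun i => f (tnth (in_tuple s) i)),
    (fun i => iota (g (tnth (in_tuple s) i))); split; last by rewrite big_tnth.
  move=> i; set w := tnth _ _.
  (* The factors are the images of [1_{xL}] and [1_{Lx^-1w}]. The middle factor [p] is absorbed by
     the first, as [1_{xL} * 1_L = 1_{xL}]. *)
  exists (iota \1_(bitranslate L x 1%g)) => //.
  exists (iota \1_(bitranslate L 1%g (x^-1 * w)%g)) => //.
  rewrite /g -(convolution_bitranslate x (x^-1 * w)%g haar oL gL muL).
  rewrite (iota_mul A_cstar); [|exact: Cc_bitranslate..].
  have := iota_mul A_cstar (Cc_bitranslate R x 1%g oL cL gL)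
    (Cc_bitranslate R 1%g 1%g oL cL gL).
  by rewrite convolution_bitranslate// bitranslate1 => <-.
apply: eB; rewrite -ball_normE /ball_ /=; apply: rnorm_lt => //.
rewrite -iE addrC -scaleN1r -(iota_linear A_cstar)//.
rewrite (iota_norm A_cstar); last exact: Cc_lincomb.
apply: le_lt_trans (cstar_norm_le _ (Cc_lincomb _ Cs Cf)) _.
apply: le_lt_trans fs _.
by rewrite ltr_pdivrMr// ltr_pMr ?ltr1n//; move: e0; rewrite ltcE => /andP[].
Qed.

End Fullness.

(** * Directedness and conjugates of the completed subgroup *)

Section DirectedHeckePair.
Local Open Scope group_scope.
Variables (G : groupType) (H : set G).
Hypothesis hH : hecke_pair H.

Lemma expandersE t : expanders H t <-> forall h, H h -> H (t^-1 * h * t).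
Proof.
split=> [Ht h /Ht[k Hk <-]|Ht h Hh].
  by rewrite !mulgA mulVg mul1g mulgVK.
by exists (t^-1 * h * t); [exact: Ht|rewrite !mulgA mulgV mul1g mulgK].
Qed.

Lemma directed_conj_cofinal (s : seq G) : directed H ->
  exists t, forall h, H h -> forall y, y \in s -> H (y^-1 * (t^-1 * h * t) * y).
Proof.
move=> dH.
suff [t [_ tP]] : exists t, expanders H t /\
    forall h, H h -> forall y, y \in s -> H (y^-1 * (t^-1 * h * t) * y).
  by exists t.
elim: s => [|y s [t [/expandersE tH tP]]].
  by exists 1; split=> //; apply/expandersE => h; rewrite invg1 mul1g mulg1.
have : [set: G] (t * y) by [].
rewrite -dH => -[a /expandersE aH [b /expandersE bH ab]].
(* Since [a * t * y = b], the new point [y] is handled by [b] being an expander; the points of [s]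
   are handled by [tP] applied to [a^-1 * h * a]. *)
exists (a * t); split.
  apply/expandersE => h /aH/tH.
  by rewrite invgM !mulgA.
move=> h Hh z; rewrite in_cons => /predU1P[->|zs].
  have yE : y = t^-1 * (a^-1 * b) by rewrite ab mulKg.
  have := bH h Hh; rewrite yE !invgM !invgK !mulgA.
  by rewrite !(mulgK, mulgVK).
have := tP _ (aH h Hh) z zs.
by rewrite invgM !mulgA.
Qed.

Lemma schlichting_sub_group : group_closed (mem (schlichting_sub hH)).
Proof.
split=> [|f g /set_mem/schlichting_subE f1 /set_mem/schlichting_subE g1];
  apply/mem_set/schlichting_subE.
  by rewrite /= theta1.
have gV : val g^-1 (lcoset H 1) = lcoset H 1.
  by rewrite -{1}g1; exact: (schlichting_invK g).
by rewrite -[RHS]f1 -{2}gV.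
Qed.

(** A basic neighbourhood of 1 consists of the permutations fixing finitely many cosets [yH].
    Conjugating by [t^-1] gives the stabilizer of [t^-1 H], and [t^-1 H t] inside each [y H y^-1]
    makes that stabilizer fix every [yH]. *)
Lemma directed_conj_nbhs (U : set (schlichting hH)) : directed H ->
  nbhs (1 : schlichting hH) U ->
  exists x, bitranslate (schlichting_sub hH) x x^-1 `<=` U.
Proof.
move=> dH /nbhs_schlichting[s sU].
have [r sr] : exists r : seq G, s = map (lcoset H) r.
  elim: s {sU} => [|c s [r ->]]; first by exists [::].
  by have [y ->] := lcoset_surj c; exists (y :: r).
have [t tP] := directed_conj_cofinal r dH.
exists (schlichting_of hH t^-1) => f.
rewrite /bitranslate /= invgK => /schlichting_subE.
set x := schlichting_of hH t^-1.
rewrite -[LHS]/(val x^-1 (val f (val x (lcoset H 1)))) => /(congr1 (val x)).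
rewrite [LHS](schlichting_invKV x) /= theta_lcoset mulg1 => ft.
apply: sU => c; rewrite sr => /mapP[y yr ->] /=; rewrite theta1.
(* As [f] is only a pointwise limit of translations, it is replaced by a group element [z] agreeing
   with it on the two cosets involved. *)
have [_ [z _ <-] zf] := (closure_coset_map _ _).1 (set_mem (valP f))
  [:: lcoset H t^-1; lcoset H y].
have Hz : H (t * z * t^-1).
  have : lcoset H t^-1 = lcoset H (z * t^-1).
    by rewrite -theta_lcoset zf ?mem_head// ft.
  by move=> /(lcoset_eqP hH); rewrite invgK mulgA.
rewrite -zf ?inE ?eqxx ?orbT// theta_lcoset.
apply/esym/(lcoset_eqP hH); have := tP _ Hz y yr.
by rewrite !mulgA !mulgVK.
Qed.

End DirectedHeckePair.

Theorem theorem6p5 (R : realType) (G : groupType) (H : set G)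
    (hH : hecke_pair H) (H_reduced : reduced H)
    (mu : {measure set (borel (schlichting hH)) -> \bar R})
    (mu_haar : left_haar mu) (mu_norm : mu (schlichting_sub hH) = 1%E)
    (A : cstarAlgType R) (iota : (schlichting hH -> R[i]) -> A)
    (A_cstar : group_cstar_algebra mu iota) :
  directed H -> full (iota \1_(schlichting_sub hH)).
Proof.
move=> dH; apply: (full_indic_open_subgroup mu_haar A_cstar) => //.
- exact: schlichting_sub_open.
- exact: schlichting_sub_compact.
- exact: schlichting_sub_group.
- by move=> U; exact: directed_conj_nbhs.
Qed.
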